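(* Assume $\mu\neq0$. For every $\beta>0$, setting $\tilde\beta=\beta/V_0(0;\beta)$, $$V_0(\pi;\beta)=1+V_0(0;\beta)\,V_{\rm c}(\pi;\tilde\beta)\quad\text{for all }\pi\in[0,1],\qquad\text{and}\qquad a^*_{\rm c}(\tilde\beta)=a^*_0(\beta).$$
   Context: Parameters $\lambda>0$, $\mu\in\mathbb R$, $\sigma>0$ are fixed; $\gamma=\mu^2/(2\sigma^2)$, $\rho=\lambda/\gamma$. The cost parameter $\beta>0$ varies and dependence on it is displayed. On a probability space with a Brownian motion $\bar W$, let $\bar\Pi$ solve $\bar\Pi_t=\bar\Pi_0+\int_0^t\lambda(1-\bar\Pi_s)\,ds+\frac\mu\sigma\int_0^t\bar\Pi_s(1-\bar\Pi_s)\,d\bar W_s$, with augmented natural filtration $(\bar{\mathcal F}_t)$; $\bar{\mathsf E}_\pi$ is the expectation when $\bar\Pi_0=\pi$; $\mathcal T(\bar{\mathcal F}_t)$ is the class of a.s. finite $(\bar{\mathcal F}_t)$-stopping times. For $\pi\in(0,1)$: $h(\pi)=\rho\{\log\frac{\pi}{1-\pi}-\frac1\pi\}$, $\psi(\pi;\beta)=-\frac{\beta}{\gamma}e^{-h(\pi)}\int_0^\pi\frac{e^{h(x)}}{x(1-x)^2}dx$, $\Psi(\pi;\beta)=\int_0^\pi\psi(x;\beta)dx$, with value $0$ at $\pi=0$. Classical problem (with unit false-alarm cost): $V_{\rm c}(\pi;\beta)=\inf_{\tau\in\mathcal T(\bar{\mathcal F}_t)}\bar{\mathsf E}_\pi\big[1-\bar\Pi_\tau+\beta\int_0^\tau\bar\Pi_t\,dt\big]$;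 its optimal stopping threshold $a^*_{\rm c}(\beta)\in(0,1)$ (it is optimal to stop when $\bar\Pi_t\ge a^*_{\rm c}(\beta)$) is the unique solution of $\psi(a;\beta)=-1$. Recursive problem with false negative rate $\epsilon=0$: $V_0(\cdot;\beta)$ is the value function, i.e. the bounded function $[0,1]\to(0,\infty)$ satisfying $$V_0(\pi;\beta)=\inf_{\tau\in\mathcal T(\bar{\mathcal F}_t)}\bar{\mathsf E}_\pi\Big[1+\beta\int_0^\tau\bar\Pi_t\,dt+(1-\bar\Pi_\tau)V_0(0;\beta)\Big],$$ for which the optimal rule is to stop when $\bar\Pi_t\ge a^*_0(\beta)$. Explicitly, $a_0^*=a^*_0(\beta)$ is the unique solution in $(0,1)$ of $1-\Psi(a;\beta)+a\psi(a;\beta)=0$, and $V_0(\pi;\beta)=\Psi(\pi;\beta)+C$ for $\pi\in[0,a_0^* )$, $V_0(\pi;\beta)=1+(1-\pi)C$ for $\pi\in[a_0^*,1]$, where $C=(1-\Psi(a_0^*;\beta))/a_0^*$. *)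

(* Defs.v *)
From mathcomp Require Import all_boot all_order all_algebra.
From mathcomp Require Import all_classical all_reals all_analysis.

Set Implicit Arguments.
Unset Strict Implicit.
Unset Printing Implicit Defensive.

Import Order.TTheory GRing.Theory Num.Theory.
Import numFieldNormedType.Exports.

Local Open Scope classical_set_scope.
Local Open Scope ring_scope.

(* Processes are functions R -> T -> R, the time index coming first; only times
   t >= 0 are ever used. *)

Section Processes.
Context {d : measure_display} {T : measurableType d} {R : realType}.
Variable P : probability T R.
Implicit Types (X W H : R -> T -> R) (G : R -> set (set T)).

Definition filtration G :=
  [/\ forall t, 0 <= t -> sigma_algebra [set: T] (G t),
      forall t, 0 <= t -> G t `<=` measurable
    & forall s t, 0 <= s -> s <= t -> G s `<=` G t].

Definition adapted G X :=
  forall t, 0 <= t -> forall B, measurable B -> G t (X t @^-1` B).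

Definition continuous_paths X :=
  forall w, {within `[0, +oo[, continuous (fun t => X t w)}.

Definition brownian_motion G W :=
  [/\ adapted G W,
      continuous_paths W,
      {ae P, forall w, W 0 w = 0},
      forall s t, 0 <= s -> s < t -> forall A B, G s A -> measurable B ->
        P (A `&` (W t \- W s)%R @^-1` B) = (P A * P ((W t \- W s)%R @^-1` B))%E
    & forall s t, 0 <= s -> s < t -> forall B, measurable B ->
        P ((W t \- W s)%R @^-1` B) = normal_prob 0 (Num.sqrt (t - s)) B].

(* Left-endpoint Riemann sum of H against W along 0 = s_0 < s_1 < ... < s_n,
   where s = [:: s_1; ...; s_n]. *)
Definition riemann_ito_sum H W (s : seq R) (w : T) : R :=
  \sum_(i < size s)
    H (nth 0 (0 :: s) i) w * (W (nth 0 s i) w - W (nth 0 (0 :: s) i) w).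

(* I is the Ito integral of H dW over [0, t]: the limit in probability of the
   left-endpoint Riemann sums as the mesh of the partition of [0, t] tends to 0.
   This is the Ito integral for adapted integrands with continuous paths, the
   only ones to which it is applied below. *)
Definition ito_integral H W (t : R) (I : T -> R) :=
  measurable_fun [set: T] I /\
  forall e : R, 0 < e -> exists2 delta : R, 0 < delta &
    forall s : seq R, itv_partition 0 t s ->
      (forall i, (i < size s)%N -> nth 0 s i - nth 0 (0 :: s) i < delta) ->
      (P [set w | (e <= `|riemann_ito_sum H W s w - I w|)%R] <= e%:E)%E.

(* dX_t = lambda (1 - X_t) dt + (mu / sigma) X_t (1 - X_t) dW_t, X_0 = x *)
Definition sde_solution (lambda mu sigma : R) G W (x : R) X :=
  [/\ adapted G X,
      continuous_paths X,
      {ae P, forall w, X 0 w = x}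
    & exists I : R -> T -> R, forall t, 0 <= t ->
        ito_integral (fun s w => X s w * (1 - X s w)) W t (I t) /\
        {ae P, forall w,
          X t w = X 0 w + \int[lebesgue_measure]_(s in `[0, t])
                              (lambda * (1 - X s w))
                        + mu / sigma * I t w}].

(* The natural filtration of X, enlarged by the (measurable) P-null sets. *)
Definition augmented_filtration X (t : R) : set (set T) :=
  <<s [set A | exists s, 0 <= s <= t /\
                 exists2 B, measurable B & A = X s @^-1` B]
      `|` [set A | measurable A /\ P A = 0%E] >>.

Definition finite_stopping_time X (tau : T -> \bar R) :=
  [/\ forall w, (0 <= tau w)%E,
      forall t, 0 <= t -> augmented_filtration X t [set w | (tau w <= t%:E)%E]
    & {ae P, forall w, (tau w < +oo)%E}].

(* Infimum, over the a.s. finite stopping times tau of the augmented filtration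
   of X, of the expectation of cost tau. *)
Definition stopping_value X (cost : (T -> \bar R) -> T -> R) : \bar R :=
  ereal_inf [set ('E_P[cost tau])%E | tau in finite_stopping_time X].

Definition optimal_stopping_time X (cost : (T -> \bar R) -> T -> R)
    (tau : T -> \bar R) :=
  finite_stopping_time X tau /\ ('E_P[cost tau])%E = stopping_value X cost.

Definition first_passage X (a : R) (w : T) : \bar R :=
  ereal_inf [set t%:E | t in [set t | 0 <= t /\ a <= X t w]].

(* In the costs below, tau is a.s. finite; fine only matters on a null set. *)

Definition running_cost X (tau : T -> \bar R) (w : T) : R :=
  \int[lebesgue_measure]_(t in `[0, fine (tau w)]) X t w.

Definition classical_cost (beta : R) X tau w : R :=
  1 - X (fine (tau w)) w + beta * running_cost X tau w.

Definition recursive_cost (beta v : R) X tau w : R :=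
  1 + beta * running_cost X tau w + (1 - X (fine (tau w)) w) * v.

End Processes.

Section ExplicitFunctions.
Context {R : realType}.
Variables lambda mu sigma : R.

Definition gamma_ : R := mu ^+ 2 / (2 * sigma ^+ 2).
Definition rho_ : R := lambda / gamma_.

Definition h_ (x : R) : R := rho_ * (ln (x / (1 - x)) - x^-1).

Definition psi (beta x : R) : R :=
  - (beta / gamma_) * expR (- h_ x) *
  \int[lebesgue_measure]_(y in `]0, x[) (expR (h_ y) / (y * (1 - y) ^+ 2)).

Definition Psi (beta x : R) : R :=
  \int[lebesgue_measure]_(y in `]0, x[) psi beta y.

End ExplicitFunctions.

Section Problems.
Context {d : measure_display} {T : measurableType d} {R : realType}.
Variables (lambda mu sigma : R) (P : probability T R).
(* X x is the posterior process started at x *)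
Variable X : R -> R -> T -> R.

Definition classical_value (beta x : R) : \bar R :=
  stopping_value P (X x) (classical_cost beta (X x)).

Record is_classical_threshold (beta a : R) : Prop := IsClassicalThreshold {
  classical_threshold_in01 : 0 < a < 1 ;
  classical_threshold_optimal : forall x, 0 <= x <= 1 ->
    optimal_stopping_time P (X x) (classical_cost beta (X x))
      (first_passage (X x) a) ;
  classical_threshold_root : psi lambda mu sigma beta a = -1 ;
  classical_threshold_unique : forall b, 0 < b < 1 ->
    psi lambda mu sigma beta b = -1 -> b = a
}.

(* The default value 0 is not in (0, 1), so it is never a threshold. *)
Definition classical_threshold (beta : R) : R :=
  xget 0 [set a | is_classical_threshold beta a].

Record is_recursive_value (beta : R) (V0 : R -> R) : Prop := IsRecursiveValue {
  recursive_value_gt0 : forall x, 0 <= x <= 1 -> 0 < V0 x ;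
  recursive_value_bounded : exists M, forall x, 0 <= x <= 1 -> V0 x <= M ;
  recursive_value_eq : forall x, 0 <= x <= 1 ->
    (V0 x)%:E = stopping_value P (X x) (recursive_cost beta (V0 0) (X x))
}.

(* The optimal threshold of the recursive problem with value function V0,
   together with the explicit form that it gives to V0. *)
Record is_recursive_threshold (beta : R) (V0 : R -> R) (a : R) : Prop :=
  IsRecursiveThreshold {
  recursive_threshold_in01 : 0 < a < 1 ;
  recursive_threshold_optimal : forall x, 0 <= x <= 1 ->
    optimal_stopping_time P (X x) (recursive_cost beta (V0 0) (X x))
      (first_passage (X x) a) ;
  recursive_threshold_root :
    1 - Psi lambda mu sigma beta a + a * psi lambda mu sigma beta a = 0 ;
  recursive_threshold_unique : forall b, 0 < b < 1 ->
    1 - Psi lambda mu sigma beta b + b * psi lambda mu sigma beta b = 0 ->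
    b = a ;
  recursive_value_below : forall x, 0 <= x < a ->
    V0 x = Psi lambda mu sigma beta x + (1 - Psi lambda mu sigma beta a) / a ;
  recursive_value_above : forall x, a <= x <= 1 ->
    V0 x = 1 + (1 - x) * ((1 - Psi lambda mu sigma beta a) / a)
}.

End Problems.

(* Main.v *)
(** Pointwise, recursive_cost beta v = 1 + v * classical_cost (beta / v) for
    v = V0 0 > 0, and expectations and infima commute with x |-> 1 + v x, so the
    two problems have affinely related values and the same optimal rules. Since
    psi is linear in beta, the equation for a0 together with the explicit value
    V0 0 = (1 - Psi a0) / a0 says that psi (beta / v) a0 = -1. The root is
    unique because psi is strictly decreasing: its integrand is kappa times the
    derivative of e^h, with kappa x = x / (rho (1 - x)) increasing, so that
    e^(-h(x)) times the integral over ]0, x[ is a weighted mean of kappa over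
    ]0, x[, with weights that move to the right as x increases. *)

Require Import Defs.
From mathcomp Require Import all_boot all_order all_algebra.
From mathcomp Require Import all_classical all_reals all_analysis.
From mathcomp Require Import measurable_realfun.
From mathcomp Require Import ring lra.

Import Order.TTheory GRing.Theory Num.Theory.
Import numFieldNormedType.Exports.

Local Open Scope classical_set_scope.
Local Open Scope ring_scope.

(** * Increasing affine maps on the extended reals *)

Lemma ereal_inf_affine (R : realType) (c v : R) (S : set \bar R) : 0 < v ->
  ereal_inf [set (c%:E + v%:E * x)%E | x in S] =
  (c%:E + v%:E * ereal_inf S)%E.
Proof.
move=> v0; rewrite -ereal_inf_pZl//; apply/eqP; rewrite eq_le; apply/andP; split.
  rewrite -leeBlDl//; apply/ereal_infP => _ [x Sx <-].
  by rewrite leeBlDl//; apply: ereal_inf_lbound; exists x.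
apply/ereal_infP => _ [x Sx <-]; rewrite leeD2l//.
by apply: ereal_inf_lbound; exists x.
Qed.

(** A positive factor sends each infinity to itself, so cancellation also works at infinite values.
    Optimality can then be transferred without first showing that the expected costs are finite. *)
Lemma affine_ereal_inj (R : realType) (c v : R) : 0 < v ->
  injective (fun x : \bar R => (c%:E + v%:E * x)%E).
Proof.
move=> v0 [x||] [y||] /=; rewrite ?(gt0_muley, gt0_muleNy) ?lte_fin//.
by move=> [] /addrI /(mulfI (lt0r_neq0 v0)) ->.
Qed.

(** * Expectation of an affine function of a random variable *)

Section Expectation.
Context {d : measure_display} {T : measurableType d} {R : realType}.
Variable P : probability T R.

(* No integrability is assumed. The positive parts of Y and 1 + v * Y have
   finite integral simultaneously, and so have the negative parts; when both
   parts are infinite, both sides are +oo - oo = -oo. *)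
Lemma expectation_affine (v : R) (Y : T -> R) : 0 < v ->
  measurable_fun [set: T] Y ->
  ('E_P[fun w => (1 + v * Y w)%R] = 1 + v%:E * 'E_P[Y])%E.
Proof.
move=> v0 mY; rewrite unlock (integralE _ _ (fun w => (1 + v * Y w)%:E)).
rewrite [X in (_ + v%:E * X)%E]integralE.
set Z := fun w => (1 + v * Y w)%:E; set Y' := fun w => (Y w)%:E.
have mY' : measurable_fun setT Y' by exact/measurable_EFinP.
have mZ : measurable_fun setT Z.
  by apply/measurable_EFinP/measurable_funD => //; apply: measurable_funM.
have [mZp mZn] := (measurable_funepos mZ, measurable_funeneg mZ).
have [mYp mYn] := (measurable_funepos mY', measurable_funeneg mY').
have posneg (z : R) : Num.max z 0 - Num.max (- z) 0 = z.
  case: (leP z 0) => z0.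
    by rewrite max_l ?oppr_ge0// opprK add0r.
  by rewrite max_r ?subr0// oppr_le0 ltW.
have pos_ge0 (z : R) : 0 <= Num.max z 0 by rewrite le_max lexx orbT.
(* The identity [Z = 1 + v Y], split into positive and negative parts and rearranged so that only
   nonnegative terms are added: the integral is then additive without integrability. *)
have E0 : (forall w, Z^\+ w + v%:E * Y'^\- w = Z^\- w + (v%:E * Y'^\+ w + 1))%E.
  move=> w; rewrite !funeposE !funenegE /Z /Y' -!EFinN -!EFin_max -!EFinM -!EFinD.
  have := posneg (1 + v * Y w); have /(congr1 (fun z => v * z)) := posneg (Y w).
  by rewrite mulrBr => ? ?; congr EFin; lra.
(* Together with [YZ] this sandwiches [v Y^-] between [Z^-] and [Z^- + 1]; the constant 1 has
   integral 1 because [P] is a probability. *)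
have ZY w : (Z^\- w <= v%:E * Y'^\- w)%E.
  rewrite !funenegE /Z /Y' -!EFinN -!EFin_max -!EFinM lee_fin ge_max.
  rewrite (mulr_ge0 (ltW v0) (pos_ge0 _)) andbT.
  have : v * (- Y w) <= v * Num.max (- Y w) 0 by rewrite ler_pM2l// le_max lexx.
  lra.
have YZ w : (v%:E * Y'^\- w <= Z^\- w + 1)%E.
  rewrite !funenegE /Z /Y' -!EFinN -!EFin_max -!EFinM -EFinD lee_fin.
  have : - (1 + v * Y w) <= Num.max (- (1 + v * Y w)) 0 by rewrite le_max lexx.
  have := pos_ge0 (- (1 + v * Y w)).
  have [? | ?] := leP (- Y w) 0; nra.
have cst1 : (\int[P]_x cst 1 x = 1)%E.
  by rewrite integral_cst// mul1e; exact: probability_setT.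
have intZ (g : T -> \bar R) : measurable_fun setT g -> (forall x, 0 <= g x)%E ->
    (\int[P]_x (v%:E * g x) = v%:E * \int[P]_x g x)%E.
  by move=> mg g0; rewrite ge0_integralZl_EFin// ltW.
have mv (g : T -> \bar R) : measurable_fun setT g ->
    measurable_fun setT (fun x => v%:E * g x)%E.
  exact: measurable_funeM.
have [vYp_ge0 vYn_ge0] : (forall w, 0 <= v%:E * Y'^\+ w)%E /\
    (forall w, 0 <= v%:E * Y'^\- w)%E.
  by split=> w; rewrite mule_ge0 ?lee_fin ?(ltW v0).
have mvYp := mv _ mYp; have mvYn := mv _ mYn.
have : (\int[P]_x (Z^\+ x + v%:E * Y'^\- x) =
        \int[P]_x (Z^\- x + (v%:E * Y'^\+ x + cst 1 x)))%E.
  by apply: eq_integral => w _; exact: E0.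
rewrite !ge0_integralD//; last 2 first.
- by move=> w _; rewrite adde_ge0.
- exact: emeasurable_funD.
rewrite !intZ// cst1.
have le1 : (\int[P]_x Z^\- x <= v%:E * \int[P]_x Y'^\- x)%E.
  by rewrite -intZ//; apply: ge0_le_integral.
have le2 : (v%:E * \int[P]_x Y'^\- x <= \int[P]_x Z^\- x + 1)%E.
  rewrite -intZ// -cst1 -ge0_integralD//; apply: ge0_le_integral => //.
  exact: emeasurable_funD.
have : (0 <= \int[P]_x Y'^\+ x)%E by exact: integral_ge0.
have : (0 <= \int[P]_x Z^\+ x)%E by exact: integral_ge0.
have : (0 <= \int[P]_x Z^\- x)%E by exact: integral_ge0.
have : (0 <= \int[P]_x Y'^\- x)%E by exact: integral_ge0.
move: (\int[P]_x Y'^\+ x)%E (\int[P]_x Z^\+ x)%E le1 le2.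
move: (\int[P]_x Z^\- x)%E (\int[P]_x Y'^\- x)%E.
(* [c], [e], [a], [b] stand for the integrals of [Z^-], [Y^-], [Y^+], [Z^+]. The infinite cases
   either compute to the same infinity on both sides or contradict the bounds; the case of four
   reals remains. *)
move=> [c||] [e||] [a||] [b||] //=; rewrite ?(gt0_muley, gt0_muleNy) ?lte_fin//.
all: try by [].
move=> _ _ _ _ _ _ E.
have {}E : b + v * e = c + (v * a + 1) by exact: EFin_inj E.
have {}E : b - c = 1 + v * (a - e) by rewrite mulrBr; lra.
exact: (congr1 EFin E).
Qed.

End Expectation.

(** * Measurability of the stopped process and of the running cost *)

Section Measurability.
Context {d : measure_display} {T : measurableType d} {R : realType}.
Implicit Types X : R -> T -> R.

Lemma cvg_truncn_grid (t : R) : 0 <= t ->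
  (Num.truncn (t * n.+1%:R))%:R / n.+1%:R @[n --> \oo] --> t.
Proof.
move=> t0; apply: (@squeeze_cvgr _ _ _ _ (fun n => t - n.+1%:R^-1) (cst t)).
- apply: nearW => n; have n0 : 0 < n.+1%:R :> R by rewrite ltr0n.
  have /andP[le_t t_lt] := truncn_itv (mulr_ge0 t0 (ltW n0)).
  rewrite ler_pdivrMr// le_t andbT ler_pdivlMr// mulrBl mulVf ?gt_eqF//.
  by rewrite lerBlDr natr1 ltW.
- rewrite -[X in _ --> X]subr0; apply: cvgB; first exact: cvg_cst.
  exact: cvg_harmonic.
- exact: cvg_cst.
Qed.

(* The max extends X to negative times, where nothing is known about it. X is
   the pointwise limit of its values at times rounded down to the grid of step
   1 / (n + 1). *)
Lemma continuous_paths_measurable X : continuous_paths X ->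
  (forall t, 0 <= t -> measurable_fun [set: T] (X t)) ->
  measurable_fun [set: R * T] (fun p => X (Num.max p.1 0) p.2).
Proof.
move=> cX mX.
pose q n (t : R) : R := (Num.truncn (t * n.+1%:R))%:R / n.+1%:R.
have pos_ge0 (z : R) : 0 <= Num.max z 0 by rewrite le_max lexx orbT.
apply: (@measurable_fun_cvg _ _ R setT
    (fun n (p : R * T) => X (q n (Num.max p.1 0)) p.2)); last first.
  move=> [t w] _ /=; have := cX w; move/subspace_continuousP => /(_ (Num.max t 0)).
  rewrite /= in_itv/= pos_ge0 => /(_ isT) Xt.
  apply: (cvg_comp _ _ _ Xt).
  move=> A /= [e /= e0 eA]; have := cvg_truncn_grid _ (pos_ge0 t).
  move=> /cvgrPdist_lt/(_ _ e0); apply: filterS => n ? ; apply: eA => //=.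
  by rewrite in_itv/= andbT divr_ge0.
move=> n _ B mB; rewrite setTI.
(* The rounded time takes countably many values [k / (n + 1)]. Where it equals one of them, the
   process is read at a fixed time, so the preimage is a countable union of measurable
   rectangles. *)
have -> : (fun p => X (q n (Num.max p.1 0)) p.2) @^-1` B =
    \bigcup_k ([set t | Num.truncn (Num.max t 0 * n.+1%:R) = k] `*`
               (X (k%:R / n.+1%:R) @^-1` B)).
  apply/seteqP; split=> [[t w] /= XB|[t w] [k _] [/= <-//]].
  by exists (Num.truncn (Num.max t 0 * n.+1%:R)).
apply: bigcup_measurable => k _; apply: measurableX; last first.
  by rewrite -[X in measurable X]setTI; apply: mX => //; rewrite divr_ge0.
have mg : measurable_fun [set: R] (fun t : R => Num.max t 0 * n.+1%:R).
  by apply: measurable_funM => //; exact: measurable_maxr.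
rewrite (_ : [set t | _] =
    (fun t => Num.max t 0 * n.+1%:R) @^-1` `[k%:R, k.+1%:R[).
  by rewrite -[X in measurable X]setTI; exact: mg.
apply/seteqP; split=> t /=; rewrite in_itv/=.
  by move=> <-; apply: truncn_itv; exact: mulr_ge0.
by rewrite -truncn_eq ?mulr_ge0// => /eqP.
Qed.

Section StoppingTime.
Variables (P : probability T R) (X : R -> T -> R) (tau : T -> \bar R).
Hypothesis X_continuous : continuous_paths X.
Hypothesis X_measurable : forall t, 0 <= t -> measurable_fun [set: T] (X t).
Hypothesis tau_stopping : finite_stopping_time P X tau.

(** The null sets among the generators are measurable themselves, so the augmentation stays inside
    the sigma-algebra of [T]. *)
Lemma augmented_filtration_measurable t :
  augmented_filtration P X t `<=` measurable.
Proof.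
apply: smallest_sub; first exact: sigma_algebra_measurable.
move=> A [[s [/andP[s0 _] [B mB ->]]]|[]//].
by rewrite -[X in measurable X]setTI; apply: X_measurable.
Qed.

Lemma finite_stopping_time_measurable : measurable_fun [set: T] tau.
Proof.
have [tau0 tau_le _] := tau_stopping.
apply: (measurability _ (ErealGenOInfty.measurableE R)) => //.
move=> _ [_ [x ->] <-]; rewrite setTI preimage_itvoy.
rewrite (_ : [set w | _] = ~` [set w | (tau w <= x%:E)%E]); last first.
  by apply/seteqP; split=> w /=; rewrite ltNge => /negP.
(* The stopping property speaks of times [t >= 0] only; for [x < 0] the event is empty because [tau]
   is nonnegative. *)
apply: measurableC; have [x0|x0] := leP 0 x.
  exact: augmented_filtration_measurable (tau_le _ x0).
rewrite (_ : [set w | _] = set0)//; apply/seteqP; split=> // w /=.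
by apply/negP; rewrite -ltNge (lt_le_trans _ (tau0 w))// lte_fin.
Qed.

(** Where [tau] is infinite, [fine] gives 0, so [S] is a nonnegative real time at every [w]. *)
Let S w := fine (tau w).

Let S_ge0 w : 0 <= S w.
Proof. by have [tau0 _ _] := tau_stopping; exact: fine_ge0. Qed.

Let S_measurable : measurable_fun [set: T] S.
Proof. exact: measurableT_comp finite_stopping_time_measurable. Qed.

Lemma stopped_process_measurable : measurable_fun [set: T] (fun w => X (S w) w).
Proof.
have -> : (fun w => X (S w) w) =
    (fun p => X (Num.max p.1 0) p.2) \o (fun w => (S w, w)).
  by apply/funext => w /=; rewrite max_l.
apply: measurableT_comp; first exact: continuous_paths_measurable.
exact: measurable_fun_pair.
Qed.

(** With the random interval turned into the indicator of the set [E] in the product space, the cost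
    is a partial integral of a jointly measurable function, to which Tonelli applies. *)
Lemma running_cost_measurable : measurable_fun [set: T] (running_cost X tau).
Proof.
pose E : set (R * T) := [set p | 0 <= p.1 <= S p.2].
pose f (p : R * T) : \bar R := (X (Num.max p.1 0) p.2 * \1_E p)%:E.
have mf : measurable_fun [set: R * T] f.
  apply/measurable_EFinP/measurable_funM.
    exact: continuous_paths_measurable.
  apply: measurable_indic.
  rewrite (_ : E = fst @^-1` `[0, +oo[ `&`
      (fun p => S p.2 - p.1) @^-1` `[0, +oo[).
    apply: measurableI; rewrite -[X in measurable X]setTI.
      exact: measurable_fst.
    have mS : measurable_fun [set: R * T] (fun p => S p.2 - p.1).
      by apply: measurable_funB => //; exact: measurableT_comp.
    exact: mS.
  by apply/seteqP; split=> p /=; rewrite !in_itv/= !andbT subr_ge0 => /andP.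
have -> : running_cost X tau =
    fine \o (fun w => \int[lebesgue_measure]_t f (t, w))%E.
  apply/funext => w; rewrite /running_cost /Rintegral /= integral_mkcond.
  congr fine; apply: eq_integral => t _; rewrite patchE /f /=.
  rewrite /E indicE; case: ifPn => tS.
    have tS' : 0 <= t <= S w by move: tS; rewrite inE/= in_itv.
    by rewrite mem_set// mulr1 max_l//; case/andP: tS'.
  rewrite memNset ?mulr0// => tS'; move/negP: tS; apply.
  by rewrite inE/= in_itv.
apply: (measurableT_comp (fine_measurable measurableT)).
(* Tonelli is stated for nonnegative functions, and no sign of [X] has been established, so the two
   parts of [f] are integrated separately. *)
rewrite (_ : (fun _ => _) = (fun w =>
    \int[lebesgue_measure]_t f^\+ (t, w) -
    \int[lebesgue_measure]_t f^\- (t, w))%E).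
  apply: emeasurable_funB; apply: measurable_fun_fubini_tonelli_G => //.
    exact: measurable_funepos.
  exact: measurable_funeneg.
apply/funext => w; rewrite integralE.
by congr (_ - _)%E; apply: eq_integral => t _; rewrite ?funeposE ?funenegE.
Qed.

End StoppingTime.
End Measurability.

(** * Strict monotonicity of [psi] on the unit interval *)

Section PsiMonotone.
Context {R : realType}.
Variables lambda mu sigma : R.
Hypotheses (lambda_gt0 : 0 < lambda) (sigma_gt0 : 0 < sigma) (mu_neq0 : mu != 0).

Local Notation leb := (@lebesgue_measure R).
Local Notation rho := (rho_ lambda mu sigma).
Local Notation h := (h_ lambda mu sigma).
Local Notation e := (fun x : R => expR (h x)).
(** The derivative of [e], since [h' = rho (1 / (x (1 - x)) + 1 / x^2) = rho / (x^2 (1 - x))]. Below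
    it, [f] is the integrand of [psi]. *)
Local Notation de := (fun x : R => rho / (x ^+ 2 * (1 - x)) * expR (h x)).
Local Notation f := (fun y : R => expR (h y) / (y * (1 - y) ^+ 2)).

Lemma gamma_gt0 : 0 < gamma_ mu sigma.
Proof.
apply: divr_gt0; first by rewrite exprn_even_gt0.
by rewrite mulr_gt0 ?exprn_gt0 ?ltr0n.
Qed.

Lemma rho_gt0 : 0 < rho.
Proof. by rewrite divr_gt0 // gamma_gt0. Qed.

Lemma is_derive_expR_h (x : R) : 0 < x < 1 ->
  is_derive x 1 e (de x).
Proof.
move=> /andP[x0 x1].
have x1' : 0 < 1 - x by rewrite subr_gt0.
have q0 : 0 < x / (1 - x) by rewrite divr_gt0.
have x0' : x != 0 by rewrite gt_eqF.
have x1n : 1 - x != 0 by rewrite gt_eqF.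
have D1 : is_derive x 1 (fun y : R => y / (1 - y)) ((1 - x) ^- 2).
  by apply: is_derive_eq; rewrite /GRing.scale/=; field.
have D2 : is_derive x 1 (fun y : R => ln (y / (1 - y))) (x * (1 - x))^-1.
  have := @is_derive1_comp _ (@ln R) (fun y => y / (1 - y)) x _ _
    (is_derive1_ln q0) D1.
  move/is_derive_eq; apply; rewrite /GRing.scale/=; field.
  by rewrite x0' x1n.
have D3 : is_derive x 1 (fun y : R => y^-1) (- x ^- 2).
  have := @is_deriveV _ id x 1 1 x0' (is_derive_id _ _).
  by move/is_derive_eq; apply; rewrite /GRing.scale/= mulr1.
have D4 : is_derive x 1 h (rho / (x ^+ 2 * (1 - x))).
  have := is_deriveZ rho (is_deriveB D2 D3).
  move/is_derive_eq; apply; rewrite /GRing.scale/=; field.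
  by rewrite x0' x1n.
have := @is_derive1_comp _ expR h x _ _ (is_derive_expR (h x)) D4.
by move/is_derive_eq; apply; rewrite /GRing.scale/= mulrC.
Qed.

Lemma continuous_expR_h (x : R) : 0 < x < 1 -> {for x, continuous e}.
Proof.
move=> /is_derive_expR_h D.
by apply: differentiable_continuous; apply/derivable1_diffP.
Qed.

Lemma continuous_derive_expR_h (x : R) : 0 < x < 1 ->
  {for x, continuous de}.
Proof.
move=> x01; have [x0 x1] := andP x01.
have ? : 1 - x != 0 by rewrite gt_eqF// subr_gt0.
have ? : x != 0 by rewrite gt_eqF.
apply: cvgM; last exact: continuous_expR_h.
apply: cvgM; first exact: cvg_cst.
apply: cvgV; first by rewrite mulf_neq0// expf_neq0.
apply: cvgM; first exact: exprn_continuous.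
by apply: cvgB; [exact: cvg_cst|exact: cvg_id].
Qed.

Lemma integral_derive_expR_h (a b : R) : 0 < a -> a < b -> b < 1 ->
  (\int[leb]_(x in `[a, b]) (de x)%:E =
   (expR (h b))%:E - (expR (h a))%:E)%E.
Proof.
move=> a0 ab b1.
have in01 (x : R) : a <= x <= b -> 0 < x < 1.
  by move=> /andP[? ?]; rewrite (lt_le_trans a0)//= (le_lt_trans _ b1).
apply: (@continuous_FTC2 _ _ e a b ab).
- apply: continuous_in_subspaceT => x; rewrite inE/= in_itv/= => /in01.
  exact: continuous_derive_expR_h.
- have c x (x01 : 0 < x < 1) := continuous_expR_h _ x01.
  split => /=.
  + move=> x; rewrite in_itv/= => /andP[? ?].
    have x01 : 0 < x < 1 by apply: in01; rewrite !ltW.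
    by have [] := is_derive_expR_h _ x01.
  + by apply: cvg_at_right_filter; apply: c; apply: in01; rewrite lexx ltW.
  + by apply: cvg_at_left_filter; apply: c; apply: in01; rewrite lexx ltW.
- move=> x; rewrite in_itv/= => /andP[? ?].
  have x01 : 0 < x < 1 by apply: in01; rewrite !ltW.
  by rewrite derive1E; have [_ ->] := is_derive_expR_h _ x01.
Qed.

(** The quotient [f / de]: the integrand of [psi] measured against the derivative of [e^h]. *)
Definition kappa (x : R) := x / (1 - x) / rho.

Lemma kappa_gt0 (x : R) : 0 < x < 1 -> 0 < kappa x.
Proof.
move=> /andP[x0 x1]; apply: divr_gt0; last exact: rho_gt0.
by rewrite divr_gt0// subr_gt0.
Qed.

Lemma odds_lt (x y : R) : 0 < x -> x < y -> y < 1 ->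
  x / (1 - x) < y / (1 - y).
Proof.
move=> x0 xy y1; rewrite ltr_pdivrMr ?subr_gt0 ?(lt_trans xy)//.
by rewrite mulrAC ltr_pdivlMr ?subr_gt0//; nra.
Qed.

Lemma kappa_lt (x y : R) : 0 < x -> x < y -> y < 1 -> kappa x < kappa y.
Proof.
by move=> x0 xy y1; rewrite ltr_pM2r ?invr_gt0 ?rho_gt0// odds_lt.
Qed.

Lemma expR_h_lt (x y : R) : 0 < x -> x < y -> y < 1 ->
  expR (h x) < expR (h y).
Proof.
move=> x0 xy y1; have y0 := lt_trans x0 xy; have x1 := lt_trans xy y1.
rewrite ltr_expR ltr_pM2l ?rho_gt0// ltrD//.
  by rewrite ltr_ln ?odds_lt// posrE divr_gt0// subr_gt0.
by rewrite ltrN2 ltf_pV2.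
Qed.

Lemma psi_integrandE (x : R) : 0 < x < 1 ->
  f x = kappa x * de x.
Proof.
move=> /andP[x0 x1]; rewrite /kappa; field.
by rewrite !gt_eqF ?rho_gt0 ?subr_gt0.
Qed.

Lemma psi_integrand_ge0 (x : R) : 0 < x < 1 -> 0 <= f x.
Proof.
move=> /andP[x0 x1]; apply/ltW/divr_gt0; first exact: expR_gt0.
by rewrite mulr_gt0// exprn_gt0// subr_gt0.
Qed.

Lemma measurable_derive_expR_h (D : set R) : measurable D -> D `<=` `]0, 1[ ->
  measurable_fun D de.
Proof.
move=> mD D01; apply: (measurable_funS _ D01) => //.
apply: open_continuous_measurable_fun; first exact: itv_open.
by move=> x; rewrite inE/= in_itv/=; exact: continuous_derive_expR_h.
Qed.

Lemma measurable_psi_integrand (D : set R) : measurable D -> D `<=` `]0, 1[ ->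
  measurable_fun D f.
Proof.
move=> mD D01; apply: (measurable_funS _ D01) => //.
apply: open_continuous_measurable_fun; first exact: itv_open.
move=> x; rewrite inE/= in_itv/= => x01; have [x0 x1] := andP x01.
have ? : 1 - x != 0 by rewrite gt_eqF// subr_gt0.
have ? : x != 0 by rewrite gt_eqF.
apply: cvgM; first exact: continuous_expR_h.
apply: cvgV; first by rewrite mulf_neq0// expf_neq0.
apply: cvgM; first exact: cvg_id.
by apply: cvgM; apply: cvgB; [exact: cvg_cst|exact: cvg_id|exact: cvg_cst|
  exact: cvg_id].
Qed.

(** On [[a, b]] the increasing factor [kappa] in [f = kappa de] lies between its end values, and
    [de] integrates to the increment of [e^h]. *)
Lemma integral_psi_integrand_bounds (a b : R) : 0 < a -> a < b -> b < 1 ->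
  ((kappa a * (expR (h b) - expR (h a)))%:E <=
    \int[leb]_(x in `[a, b]) (f x)%:E <=
  (kappa b * (expR (h b) - expR (h a)))%:E)%E.
Proof.
move=> a0 ab b1.
have in01 (x : R) : a <= x <= b -> 0 < x < 1.
  by move=> /andP[? ?]; rewrite (lt_le_trans a0)//= (le_lt_trans _ b1).
have ab01 : `[a, b] `<=` `]0, 1[ by move=> x/=; rewrite !in_itv/=; exact: in01.
have ka : 0 < kappa a by apply: kappa_gt0; rewrite a0 (lt_trans ab).
have kb : 0 < kappa b by apply: kappa_gt0; rewrite b1 (lt_trans a0).
have k_le (x y : R) : 0 < x -> x <= y -> y < 1 -> kappa x <= kappa y.
  rewrite le_eqVlt => x0 /predU1P[->//|xy y1].
  exact/ltW/kappa_lt.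
have g0 (x : R) : 0 < x < 1 -> 0 <= de x.
  move=> /andP[x0 x1]; rewrite mulr_ge0 ?expR_ge0// divr_ge0 ?ltW ?rho_gt0//.
  by rewrite mulr_gt0 ?exprn_gt0// subr_gt0.
have mg : measurable_fun `[a, b] de by exact: measurable_derive_expR_h.
have mf : measurable_fun `[a, b] f by exact: measurable_psi_integrand.
have intE (k : R) : 0 <= k ->
    ((k * (expR (h b) - expR (h a)))%:E =
    \int[leb]_(x in `[a, b]) (k * de x)%:E)%E.
  move=> k0; under eq_integral do rewrite EFinM.
  rewrite ge0_integralZl_EFin//.
  - by rewrite integral_derive_expR_h.
  - by move=> x; rewrite /= in_itv/= lee_fin => /in01; exact: g0.
  - exact/measurable_EFinP.
have mkg (k : R) : measurable_fun `[a, b] (fun x : R => (k * de x)%:E).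
  by apply/measurable_EFinP/measurable_funM => //; exact: measurable_cst.
apply/andP; split; (rewrite intE; last exact: ltW); apply: ge0_le_integral => //.
- by move=> x; rewrite /= in_itv/= lee_fin => /in01/g0; exact/mulr_ge0/ltW.
- exact: mkg.
- exact/measurable_EFinP.
- move=> x; rewrite /= in_itv/= lee_fin => xab; have /andP[x0 x1] := in01 _ xab.
  rewrite psi_integrandE ?x0// ler_wpM2r ?g0 ?x0//; have [? ?] := andP xab.
  exact: k_le.
- by move=> x; rewrite /= in_itv/= lee_fin => /in01; exact: psi_integrand_ge0.
- exact/measurable_EFinP.
- exact: mkg.
- move=> x; rewrite /= in_itv/= lee_fin => xab; have /andP[x0 x1] := in01 _ xab.
  rewrite psi_integrandE ?x0// ler_wpM2r ?g0 ?x0//; have [? ?] := andP xab.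
  exact: k_le.
Qed.

(** The upper bound on [[a, b]] survives the limit [a -> 0] once the negative term [- e^h(a)] is
    dropped. Besides its value, this gives the finiteness of the integral that defines [psi]. *)
Lemma integral_psi_integrand_le (b : R) : 0 < b -> b < 1 ->
  (\int[leb]_(x in `]0%R, b[) (f x)%:E <= (kappa b * expR (h b))%:E)%E.
Proof.
move=> b0 b1.
have b01 : `]0, b] `<=` `]0, 1[.
  by move=> x/=; rewrite !in_itv/= => /andP[-> /le_lt_trans]; exact.
have mf (D : set R) : measurable D -> D `<=` `]0, b] ->
    measurable_fun D (fun x => (f x)%:E).
  move=> mD Db; apply/measurable_EFinP.
  exact: measurable_psi_integrand mD (subset_trans Db b01).
rewrite integral_itv_bndo_bndc; last first.
  by apply: (mf _ (measurable_itv _)); apply: subset_itvl; rewrite bnd_simp.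
(* The offset 2 keeps the left end strictly below [b] already at [n = 0], as the bounds on compact
   intervals require. *)
pose F (n : nat) := `[b / n.+2%:R, b]%classic.
have F0 n : F n `<=` `]0, b].
  move=> x; rewrite /F/= !in_itv/= => /andP[bx ->]; rewrite andbT.
  by rewrite (lt_le_trans _ bx)// divr_gt0.
have UF : \bigcup_n F n = `]0, b]%classic.
  apply/seteqP; split=> [x [n _] /F0//|x /=]; rewrite in_itv/= => /andP[x0 xb].
  (* For this [n] one has [b / x < n + 1 <= n + 2], hence [b / (n + 2) <= x]. *)
  exists (Num.truncn (b / x)) => //; rewrite /F/= in_itv/= xb andbT.
  rewrite ler_pdivrMr ?ltr0n// mulrC -ler_pdivrMr//.
  by rewrite (le_trans (ltW (truncnS_gt _)))// ler_nat.
have F_nd : nondecreasing_seq F.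
  move=> m n mn; apply/subsetPset => x; rewrite /F/= !in_itv/= => /andP[bx ->].
  rewrite andbT (le_trans _ bx)// ler_pM2l// lef_pV2 ?posrE ?ltr0n//.
  by rewrite ler_nat.
have cvgF : (\int[leb]_(x in F i) (f x)%:E @[i --> \oo] -->
    \int[leb]_(x in `]0%R, b]) (f x)%:E)%E.
  rewrite -UF; apply: ge0_nondecreasing_set_cvg_integral => //.
  - by move=> i; exact: measurable_itv.
  - by move=> i; exact: (mf _ (measurable_itv _) (F0 i)).
  - move=> i x /F0 /b01 /=.
    by rewrite in_itv/= lee_fin; exact: psi_integrand_ge0.
rewrite -(cvg_lim _ cvgF)//; apply: lime_le; first exact: cvgP cvgF.
apply: nearW => n.
have bn : b / n.+2%:R < b by rewrite ltr_pdivrMr ?ltr0n// ltr_pMr// ltr1n.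
have bn0 : 0 < b / n.+2%:R by rewrite divr_gt0.
have /andP[_ /le_trans] := integral_psi_integrand_bounds _ _ bn0 bn b1.
apply; rewrite lee_fin ler_pM2l ?kappa_gt0 ?b0//.
by rewrite gerBl expR_ge0.
Qed.

Lemma integral_psi_integrand_split (a b : R) : 0 < a -> a < b -> b < 1 ->
  (\int[leb]_(x in `]0%R, b[) (f x)%:E =
   \int[leb]_(x in `]0%R, a[) (f x)%:E + \int[leb]_(x in `[a, b]) (f x)%:E)%E.
Proof.
move=> a0 ab b1.
have b01 : `]0, b] `<=` `]0, 1[.
  by move=> x/=; rewrite !in_itv/= => /andP[-> /le_lt_trans]; exact.
have mf (D : set R) : measurable D -> D `<=` `]0, b] ->
    measurable_fun D (fun x => (f x)%:E).
  move=> mD Db; apply/measurable_EFinP.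
  exact: measurable_psi_integrand mD (subset_trans Db b01).
rewrite integral_itv_bndo_bndc; last first.
  by apply: (mf _ (measurable_itv _)); apply: subset_itvl; rewrite bnd_simp.
have E : `]0, b]%classic = `]0, a[%classic `|` `[a, b]%classic.
  by rewrite -itv_bndbnd_setU// bnd_simp// ltW.
rewrite E ge0_integral_setU//=.
- by rewrite -E; apply: mf.
- have ab0b x : (`]0, a[%classic `|` `[a, b]%classic) x -> `]0, b]%classic x.
    by rewrite E.
  move=> x /ab0b.
  by move=> /b01; rewrite /= in_itv/= lee_fin; exact: psi_integrand_ge0.
- rewrite disj_set2E; apply/eqP/seteqP; split => // x [] /=; rewrite !in_itv/=.
  by move=> /andP[_ /lt_geF ->].
Qed.

(** Up to the factor [- beta / gamma], [psi] is the ratio of [F] to [e^h]. From [a] to [b] this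
    ratio grows: the increment of [F] is at least [kappa a] times that of [e^h], while the ratio at
    [a] is strictly below [kappa a]. *)
Lemma psi_decreasing (beta a b : R) : 0 < beta -> 0 < a -> a < b -> b < 1 ->
  psi lambda mu sigma beta b < psi lambda mu sigma beta a.
Proof.
move=> beta0 a0 ab b1.
pose F x := \int[leb]_(y in `]0%R, x[) f y.
have in01 (x : R) : 0 < x -> x <= b -> 0 < x < 1.
  by move=> -> /le_lt_trans; apply.
(* [F] is a real integral, which would default to 0 if the extended one were infinite; the preceding
   bound excludes this. *)
have FE x : 0 < x -> x <= b ->
    (\int[leb]_(y in `]0%R, x[) (f y)%:E = (F x)%:E)%E.
  move=> x0 xb; have /andP[_ x1] := in01 _ x0 xb.
  rewrite /F /Rintegral fineK// ge0_fin_numE.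
    by rewrite (le_lt_trans (integral_psi_integrand_le _ _ _)) ?ltry.
  apply: integral_ge0 => y; rewrite /= in_itv/= lee_fin => /andP[y0 yx].
  by apply/psi_integrand_ge0/in01 => //; rewrite (le_trans (ltW yx)).
have Fle x : 0 < x -> x <= b -> F x <= kappa x * expR (h x).
  move=> x0 xb; rewrite -lee_fin -FE//; apply: integral_psi_integrand_le => //.
  exact: le_lt_trans b1.
have Fincr x y : 0 < x -> x < y -> y <= b ->
    kappa x * (expR (h y) - expR (h x)) <= F y - F x <=
    kappa y * (expR (h y) - expR (h x)).
  move=> x0 xy yb; have y1 := le_lt_trans yb b1.
  have := integral_psi_integrand_bounds _ _ x0 xy y1.
  have := integral_psi_integrand_split _ _ x0 xy y1.
  rewrite (FE y (lt_trans x0 xy) yb) (FE x x0 (le_trans (ltW xy) yb)).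
  move: (integral _ _ _) => [r||]// Fxy.
  have -> : F y - F x = r.
    by apply/eqP; rewrite subr_eq addrC; apply/eqP/EFin_inj.
  by rewrite !lee_fin.
have a2 : a / 2 < a by rewrite ltr_pdivrMr// ltr_pMr// ltr1n.
have a20 : 0 < a / 2 by rewrite divr_gt0.
(* The bound of Fle is strict, since kappa is smaller on ]0, a / 2[. *)
have Fa : F a < kappa a * expR (h a).
  have /andP[_] := Fincr _ _ a20 a2 (ltW ab).
  have := Fle _ a20 (ltW (lt_trans a2 ab)).
  have := kappa_lt _ _ a20 a2 (lt_trans ab b1).
  have := expR_gt0 (h (a / 2)).
  move: (kappa (a / 2)) (kappa a) (F a) (F (a / 2)) => k k' y y' + + + +.
  nra.
(* The claim [F a / e^h(a) < F b / e^h(b)] with denominators cleared. Multiply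
   [F b - F a >= kappa a (e^h(b) - e^h(a))] by [e^h(a)] and replace [kappa a e^h(a)] by the smaller
   [F a]. *)
have Fb : F a * expR (h b) < F b * expR (h a).
  have /andP[+ _] := Fincr _ _ a0 ab (lexx b).
  have := expR_h_lt _ _ a0 ab b1; have := expR_gt0 (h a); move: Fa.
  move: (kappa a) (F a) (F b) (expR (h a)) (expR (h b)) => k y y' e e'.
  nra.
rewrite /psi !mulNr ltrN2 -!mulrA !ltr_pM2l ?invr_gt0 ?gamma_gt0//.
rewrite -/(F a) -/(F b) !expRN ![_^-1 * _]mulrC.
by rewrite ltr_pdivrMr ?expR_gt0// mulrAC ltr_pdivlMr ?expR_gt0.
Qed.

End PsiMonotone.

(** * Passage from the recursive to the classical stopping problem *)

Section Problems.
Context {d : measure_display} {T : measurableType d} {R : realType}.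
Variables (P : probability T R) (X : R -> T -> R) (beta v : R).
Hypothesis v_gt0 : 0 < v.
Hypothesis X_continuous : continuous_paths X.
Hypothesis X_measurable : forall t, 0 <= t -> measurable_fun [set: T] (X t).

Lemma recursive_costE tau :
  recursive_cost beta v X tau =
  fun w => 1 + v * classical_cost (beta / v) X tau w.
Proof.
apply/funext => w; rewrite /recursive_cost /classical_cost; field.
exact: lt0r_neq0.
Qed.

Lemma expectation_recursive_cost tau : finite_stopping_time P X tau ->
  ('E_P[recursive_cost beta v X tau] =
   1 + v%:E * 'E_P[classical_cost (beta / v) X tau])%E.
Proof.
move=> tau_stopping; rewrite recursive_costE; apply: expectation_affine => //.
apply: measurable_funD.
  apply: measurable_funB => //.
  exact: stopped_process_measurable tau_stopping.
by apply: measurable_funM => //; exact: running_cost_measurable tau_stopping.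
Qed.

Lemma stopping_value_recursive_cost :
  (stopping_value P X (recursive_cost beta v X) =
   1 + v%:E * stopping_value P X (classical_cost (beta / v) X))%E.
Proof.
rewrite /stopping_value -ereal_inf_affine// image_comp; congr ereal_inf.
(* The expectations are compared only at admissible [tau], for which the cost is known to be
   measurable. *)
by apply: eq_imagel => tau; exact: expectation_recursive_cost.
Qed.

(** Both problems range over the same stopping times, so it suffices to cancel the affine map in the
    equality between expected cost and infimum. *)
Lemma optimal_stopping_time_recursive_cost tau :
  optimal_stopping_time P X (recursive_cost beta v X) tau ->
  optimal_stopping_time P X (classical_cost (beta / v) X) tau.
Proof.
move=> [tau_stopping]; rewrite stopping_value_recursive_cost.
rewrite expectation_recursive_cost// => /(affine_ereal_inj _ _ _ v_gt0).
by split.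
Qed.

End Problems.

Theorem proposition5p6 (R : realType) (d : measure_display)
    (T : measurableType d) (P : probability T R)
    (lambda mu sigma : R)
    (lambda_gt0 : 0 < lambda) (sigma_gt0 : 0 < sigma) (mu_neq0 : mu != 0)
    (G : R -> set (set T)) (G_filtration : filtration G)
    (W : R -> T -> R) (W_brownian : brownian_motion P G W)
    (X : R -> R -> T -> R)
    (X_sde : forall x : R, 0 <= x <= 1 ->
       sde_solution P lambda mu sigma G W x (X x))
    (beta : R) (beta_gt0 : 0 < beta)
    (V0 : R -> R) (V0_value : is_recursive_value P X beta V0) :
  let beta' := beta / V0 0 in
  (forall x : R, 0 <= x <= 1 ->
     (V0 x)%:E = (1 + (V0 0)%:E * classical_value P X beta' x)%E) /\
  (forall a0 : R, is_recursive_threshold lambda mu sigma P X beta V0 a0 ->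
     classical_threshold lambda mu sigma P X beta' = a0).
Proof.
have X_cont x (x01 : 0 <= x <= 1) : continuous_paths (X x).
  by have [] := X_sde _ x01.
have X_meas x (x01 : 0 <= x <= 1) t :
    0 <= t -> measurable_fun [set: T] (X x t).
  have [_ G_measurable _] := G_filtration.
  have [X_adapted _ _ _] := X_sde _ x01.
  move=> t0 _ B mB; rewrite setTI.
  by apply: (G_measurable _ t0); exact: X_adapted.
have v_gt0 : 0 < V0 0.
  by apply: recursive_value_gt0 V0_value _ _; rewrite lexx ler01.
split=> [x x01|a0 a0_thr].
  rewrite (recursive_value_eq V0_value x01) /classical_value.
  exact: stopping_value_recursive_cost (X_cont _ x01) (X_meas _ x01).
have /andP[a0_gt0 a0_lt1] := recursive_threshold_in01 a0_thr.
have beta'_gt0 : 0 < beta / V0 0 by rewrite divr_gt0.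
have root : psi lambda mu sigma (beta / V0 0) a0 = -1.
  (* The point 0 lies below the threshold, and [Psi] vanishes there as an integral over an empty
     interval. *)
  have V00 : V0 0 = (1 - Psi lambda mu sigma beta a0) / a0.
    rewrite (recursive_value_below a0_thr) ?lexx//.
    by rewrite /Psi set_itvoo0 Rintegral_set0 add0r.
  have psiE : psi lambda mu sigma beta a0 = - V0 0.
    rewrite V00 -mulNr; apply: (canRL (mulfK (lt0r_neq0 a0_gt0))).
    by have := recursive_threshold_root a0_thr; lra.
  have -> : psi lambda mu sigma (beta / V0 0) a0 =
      psi lambda mu sigma beta a0 / V0 0.
    by rewrite /psi; ring.
  by rewrite psiE mulNr divff// lt0r_neq0.
have uniq b : 0 < b < 1 -> psi lambda mu sigma (beta / V0 0) b = -1 -> b = a0.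
  move=> /andP[b_gt0 b_lt1] b_root.
  have psi_lt x y :=
    @psi_decreasing _ _ _ _ lambda_gt0 sigma_gt0 mu_neq0 _ x y beta'_gt0.
  have [ba|ab|//] := ltgtP b a0.
    by have := psi_lt _ _ b_gt0 ba a0_lt1; rewrite root b_root ltxx.
  by have := psi_lt _ _ a0_gt0 ab b_lt1; rewrite root b_root ltxx.
have a0_classical : is_classical_threshold lambda mu sigma P X (beta / V0 0) a0.
  split=> //; first exact: recursive_threshold_in01 a0_thr.
  move=> x x01; apply: optimal_stopping_time_recursive_cost => //.
  - exact: X_cont.
  - exact: X_meas.
  - exact: (recursive_threshold_optimal a0_thr).
(* [xget] may pick any classical threshold, but each is a root of [psi = -1] in [(0, 1)] and so
   equals [a0]. The default branch is excluded because [a0] is one. *)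
rewrite /classical_threshold; case: xgetP => [a _ [a01 _ a_root _]|/(_ a0)//].
exact: uniq.
Qed.
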